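(* Let $p,q\ge 2$ be integers, $(\beta,h)\in\Theta=(0,\infty)\times[0,\infty)$, and let $\beta_N\to\beta$ and $h_N\to h$. Then, under $\mathbb P_{\beta_N,h_N,N}$, the empirical magnetization $\bar{\boldsymbol X}_N$ satisfies a large deviation principle with speed $N$ and rate function $-H_{\beta,h}+\sup H_{\beta,h}$. Consequently, for every $\varepsilon>0$ there exists a constant $C_{q,\varepsilon}>0$ depending only on $q$ and $\varepsilon$, such that $$\mathbb P_{\beta_N,h_N,N}\left(d(\bar{\boldsymbol X}_N,\mathcal M_{\beta,h})\ge\varepsilon\right)\le e^{-C_{q,\varepsilon}N}$$ for all large $N$.
   Context: For real $\beta,h$ and $N\ge1$, $\mathbb P_{\beta,h,N}$ is the $p$-tensor Curie-Weiss Potts model: the probability measure on $\{1,\dots,q\}^N$ with $\mathbb P_{\beta,h,N}(\boldsymbol X)\propto\exp\left(\beta N\sum_{r=1}^q\bar X_{\cdot r}^p+Nh\bar X_{\cdot1}\right)$, where $\bar X_{\cdot r}=N^{-1}\#\{i:X_i=r\}$. The empirical magnetization is $\bar{\boldsymbol X}_N=(\bar X_{\cdot1},\dots,\bar X_{\cdot q})^\top$. $\mathcal P_q$ is the set of all $q$-dimensional probability vectors, and $H_{\beta,h}:\mathcal P_q\to\mathbb R$ is the negative free energy function $H_{\beta,h}(\boldsymbol t)=\beta\sum_{r=1}^q t_r^p+ht_1-\sum_{r=1}^q t_r\log t_r$ (with $0\log0=0$); the supremum of $H_{\beta,h}$ is over $\mathcal P_q$. $\mathcal M_{\beta,h}$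 is the set of all global maximizers of $H_{\beta,h}$, and $d(\boldsymbol t,A)=\inf_{\boldsymbol a\in A}\|\boldsymbol t-\boldsymbol a\|_2$ for $\boldsymbol t\in\mathbb R^q$, $A\subseteq\mathbb R^q$.
   Formalization: The constant C may depend on p, β and h as well as on q and ε (not on N or the sequences β_N, h_N); one depending only on q and ε is impossible: for p=q=2, β large, h→0+, the swapped maximizer forces C ≤ h. *)

(* Defs.v *)
From HB Require Import structures.
From mathcomp Require Import all_boot all_order all_algebra.
From mathcomp Require Import all_classical all_reals all_analysis.

Set Implicit Arguments.
Unset Strict Implicit.
Unset Printing Implicit Defensive.

Import Order.TTheory GRing.Theory Num.Theory.
Import numFieldNormedType.Exports.

Local Open Scope classical_set_scope.
Local Open Scope ring_scope.

(* mu_n A is only required to make sense for Borel sets A. Since lne 0 = -oo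
   and ereal_inf set0 = +oo, both bounds have their usual meaning also when
   mu_n A = 0 or when the infimum is over an empty set. *)
Definition large_deviation_principle (R : realType) (T : topologicalType)
    (mu : nat -> set T -> \bar R) (speed : nat -> R) (I : T -> \bar R) : Prop :=
  [/\ (forall t, 0 <= I t)%E,
      lower_semicontinuous I &
      forall A : set T, <<s @open T >> A ->
        let exponent n := ((speed n)^-1%:E * lne (mu n A))%E in
        (- ereal_inf (I @` interior A) <= limn_einf exponent)%E /\
        (limn_esup exponent <= - ereal_inf (I @` closure A))%E].

(* Colours 1, ..., q are represented by 'I_q; the field acts on the first. *)
Definition color1 (q : nat) (hq : (2 <= q)%N) : 'I_q := Ordinal (ltnW hq).

Definition simplex (R : realType) (q : nat) : set 'rV[R]_q :=
  [set t | (forall r, 0 <= t 0 r) /\ \sum_(r < q) t 0 r = 1].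
Arguments simplex R q : clear implicits.

(* The convention 0 log 0 = 0 holds because ln 0 = 0 (and 0 * _ = 0). *)
Definition neg_free_energy (R : realType) (p q : nat) (r1 : 'I_q) (beta h : R)
    (t : 'rV[R]_q) : R :=
  beta * \sum_(r < q) t 0 r ^+ p + h * t 0 r1 - \sum_(r < q) t 0 r * ln (t 0 r).

Definition maximizers (R : realType) (p q : nat) (r1 : 'I_q) (beta h : R) :
    set 'rV[R]_q :=
  [set t | simplex R q t /\ forall s, simplex R q s ->
     neg_free_energy p r1 beta h s <= neg_free_energy p r1 beta h t].

Definition rate_function (R : realType) (p q : nat) (r1 : 'I_q) (beta h : R)
    (t : simplex R q) : \bar R :=
  (- neg_free_energy p r1 beta h (set_val t)
   + sup (neg_free_energy p r1 beta h @` simplex R q))%:E.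

(* The library norm on 'rV[R]_q is the sup norm. *)
Definition l2norm (R : realType) (q : nat) (t : 'rV[R]_q) : R :=
  Num.sqrt (\sum_(r < q) t 0 r ^+ 2).

Definition l2dist (R : realType) (q : nat) (t : 'rV[R]_q) (A : set 'rV[R]_q) :
    \bar R :=
  ereal_inf [set (l2norm (t - a))%:E | a in A].

(* The sample space {1, ..., q}^N with the discrete sigma-algebra; r1 is only
   there because measurable types must be pointed. *)
Definition config (q : nat) (r1 : 'I_q) (N : nat) : Type := {ffun 'I_N -> 'I_q}.

HB.instance Definition _ (q : nat) (r1 : 'I_q) (N : nat) :=
  Finite.on (config r1 N).

HB.instance Definition _ (q : nat) (r1 : 'I_q) (N : nat) :=
  isPointed.Build (config r1 N) ([ffun=> r1] : {ffun 'I_N -> 'I_q}).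

HB.instance Definition _ (q : nat) (r1 : 'I_q) (N : nat) :=
  @isMeasurable.Build default_measure_display (config r1 N)
    discrete_measurable discrete_measurable0
    discrete_measurableC discrete_measurableU.

Definition magnetization (R : realType) (q : nat) (r1 : 'I_q) (N : nat)
    (X : config r1 N) : 'rV[R]_q :=
  \row_(r < q) (#|[set i | X i == r]%SET|%:R / N%:R).

Lemma magnetization_simplex (R : realType) (q : nat) (r1 : 'I_q) (N : nat)
    (X : config r1 N) :
  (0 < N)%N -> simplex R q (magnetization R X).
Proof.
move=> N0; split=> [r|]; first by rewrite mxE divr_ge0.
under eq_bigr do rewrite mxE.
rewrite -mulr_suml -natr_sum.
suff -> : (\sum_(r < q) #|[set i | X i == r]%SET| = N)%N.
  by rewrite divff// pnatr_eq0 -lt0n.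
under eq_bigr do rewrite cardsE -sum1_card.
rewrite -[RHS]card_ord -sum1_card (partition_big X predT)//=.
Qed.

Section potts.
Context (R : realType) (p q N : nat) (r1 : 'I_q) (beta h : R).

Definition boltzmann (X : config r1 N) : R :=
  expR (beta * N%:R * (\sum_(r < q) magnetization R X 0 r ^+ p)
        + N%:R * h * magnetization R X 0 r1).

Definition partition_function : R := \sum_(X : config r1 N) boltzmann X.

Definition potts (A : set (config r1 N)) : \bar R :=
  (\sum_(X : config r1 N)
     (boltzmann X / partition_function)%:E * \d_X A)%E.

Let weight_ge0 X : 0 <= boltzmann X / partition_function.
Proof. by rewrite divr_ge0 ?expR_ge0// sumr_ge0// => Y _; exact: expR_ge0. Qed.

Let potts0 : potts set0 = 0%E.
Proof. by rewrite /potts big1// => X _; rewrite measure0 mule0. Qed.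

Let potts_ge0 A : (0 <= potts A)%E.
Proof. by apply: sume_ge0 => X _; rewrite mule_ge0// lee_fin. Qed.

Let potts_sigma_additive : semi_sigma_additive potts.
Proof.
move=> F mF tF mUF; rewrite /potts.
under eq_fun do rewrite exchange_big/=.
apply: cvg_nnesum => X _.
  by apply: nearW => n; apply: sume_ge0 => k _; rewrite mule_ge0// lee_fin.
exact: (@measure_semi_sigma_additive _ _ _
  (mscale (NngNum (weight_ge0 X)) (\d_X)) F mF tF mUF).
Qed.

HB.instance Definition _ := isMeasure.Build _ _ _ potts
  potts0 potts_ge0 potts_sigma_additive.

Let potts_setT : potts [set: config r1 N] = 1%E.
Proof.
rewrite /potts; under eq_bigr do rewrite diracT mule1.
rewrite sumEFin -mulr_suml divff// gt_eqF// /partition_function.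
rewrite (bigD1 [ffun=> r1])//= ltr_pwDl ?expR_gt0//.
by apply: sumr_ge0 => X _; exact: expR_ge0.
Qed.

HB.instance Definition _ := @Measure_isProbability.Build _ _ R potts potts_setT.

(* The law of the empirical magnetization as a random element of the simplex,
   endowed with the subspace topology; see magnetization_simplex. *)
Definition magnetization_law (A : set (simplex R q)) : \bar R :=
  potts [set X | (set_val @` A) (magnetization R X)].

End potts.

Arguments potts {R} p {q} N r1 beta h A.
Arguments magnetization_law {R} p {q} N r1 beta h A.

(* Main.v *)
Require Import Defs.
From mathcomp Require Import all_boot all_order all_algebra.
From mathcomp Require Import all_classical all_reals all_analysis.
From mathcomp Require Import ring lra.

Set Implicit Arguments.
Unset Strict Implicit.
Unset Printing Implicit Defensive.

Import Order.TTheory GRing.Theory Num.Theory.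
Import numFieldNormedType.Exports.

Local Open Scope classical_set_scope.
Local Open Scope ring_scope.

(** Write H for the negative free energy, E(t) = beta sum_r t_r^p + h t_1 for its
    interaction part, so that H(t) = E(t) - sum_r t_r ln t_r, and x(X) for the
    magnetization of a configuration X. The Boltzmann weight of X is
    exp(N E(x(X))). Everything reduces to estimating, for a set A of
    configurations, the restricted partition function Z_N(A), the sum of these
    weights over A, since the probability of A is Z_N(A) / Z_N(everything).

    The entropy comes from comparison with product measures. For a probability
    vector t let Q_t(X) = prod_i t_(X_i). Since
    Q_t(X) <= exp(N sum_r x_r(X) ln t_r), with equality at t = x(X), the Boltzmann
    weight is on the one hand exp(N H(x(X))) Q_(x(X))(X), and on the other hand
    at least Q_t(X) exp(N (E(x(X)) - sum_r x_r(X) ln t_r)) for every t.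

    - Upper bound. The sum of Q_(x(X))(X) over all X is at most (N+1)^q, because
      there are at most that many values of x and each Q_t has total mass 1.
      Hence Z_N(A) <= (N+1)^q exp(N m) if H(x(X)) <= m on A
      (restricted_partition_le).
    - Lower bound. By the Chebyshev inequality Q_t gives mass at least
      1 - q/(N d) to the configurations with |x(X) - t|^2 < d, and on these
      E(x(X)) - sum_r x_r(X) ln t_r is close to its value H(t) at x(X) = t. Hence
      Z_N(A) >= exp(N (H(t) - eps)) for large N if A contains every X with x(X)
      near t (restricted_partition_ge).

    Replacing (beta, h) by (beta_N, h_N) changes E uniformly little on the simplex.
    Dividing the two bounds gives near_potts_le and near_potts_ge, which are the
    two halves of the large deviation principle. The upper bound holds with the
    supremum of H over A itself, a fortiori with that over its closure. Lower
    semicontinuity of the rate is continuity of H. For the concentration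
    statement, H is continuous and the points of the simplex at distance at least
    eps from the maximizers form a compact set, so H stays below its maximum there
    by a fixed gap (neg_free_energy_gap); half of the gap is the constant C. *)

(** * Product measures on configurations *)

Section iid.
Context (R : realType) (q N : nat) (r1 : 'I_q).
Implicit Types (t : 'rV[R]_q) (X : config r1 N).

Definition iid_weight t X : R := \prod_(i < N) t 0 (X i).

Lemma sum_iid_weightM t (g : 'I_N -> 'I_q -> R) :
  \sum_X iid_weight t X * \prod_(i < N) g i (X i) =
  \prod_(i < N) \sum_(r < q) t 0 r * g i r.
Proof.
rewrite bigA_distr_bigA/=; apply: eq_bigr => X _.
by rewrite -big_split.
Qed.

Lemma sum_iid_weight t :
  \sum_(r < q) t 0 r = 1 -> \sum_X iid_weight t X = 1.
Proof.
move=> t1; have := sum_iid_weightM t (fun _ _ => 1).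
under eq_bigr do rewrite big1// mulr1.
by move=> ->; rewrite big1// => i _; under eq_bigr do rewrite mulr1.
Qed.

Lemma iid_weight_ge0 t X : (forall r, 0 <= t 0 r) -> 0 <= iid_weight t X.
Proof. by move=> t0; exact: prodr_ge0. Qed.

Lemma sum_sites (g : 'I_q -> R) X :
  \sum_(i < N) g (X i) = N%:R * \sum_(r < q) magnetization R X 0 r * g r.
Proof.
case: (posnP N) X => [N0 X|N0 X].
  have -> : N%:R = 0 :> R by rewrite N0.
  by rewrite mul0r big1// => i _; have := ltn_ord i; rewrite {2}N0.
rewrite (partition_big (fun i => X i) predT)//= mulr_sumr; apply: eq_bigr => r _.
rewrite mxE mulrA mulrCA divff ?pnatr_eq0 -?lt0n// mulr1.
rewrite (eq_bigr (fun=> g r)); last by move=> i /eqP ->.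
rewrite sumr_const mulr_natl; congr (_ *+ _).
by rewrite cardsE.
Qed.

(** The second moment of a sum of independent centred variables: in the expanded
    square, an off-diagonal term contains the factor [sum_r t_r f_r = 0]. *)
Lemma sum_iid_weight_sqr t (f : 'I_q -> R) :
  \sum_(r < q) t 0 r = 1 -> \sum_(r < q) t 0 r * f r = 0 ->
  \sum_X iid_weight t X * (\sum_(i < N) f (X i)) ^+ 2 =
  N%:R * \sum_(r < q) t 0 r * f r ^+ 2.
Proof.
move=> t1 tf0.
(* [f (X i) * f (X j)] as a product over all sites, the form in which sums
   against the product weight factorize. *)
pose g (i j k : 'I_N) r :=
  (if k == i then f r else 1) * (if k == j then f r else 1).
have gE i j X : \prod_k g i j k (X k) = f (X i) * f (X j).
  by rewrite big_split/= -!big_mkcond/= !big_pred1_eq.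
under eq_bigr => X _.
  rewrite expr2 big_distrlr/= mulr_sumr.
  under eq_bigr do rewrite mulr_sumr.
  over.
rewrite exchange_big/=; under eq_bigr do rewrite exchange_big/=.
under eq_bigr => i _.
  under eq_bigr => j _.
    under eq_bigr do rewrite -gE.
    rewrite sum_iid_weightM; over.
  rewrite (bigD1 i)//= [X in _ + X]big1 ?addr0; last first.
    move=> j ji; rewrite (bigD1 i)//= [X in X * _](_ : _ = 0) ?mul0r//.
    rewrite -[RHS]tf0; apply: eq_bigr => r _.
    by rewrite /g eqxx eq_sym (negbTE ji) mulr1.
  rewrite (bigD1 i)//= [X in _ * X]big1 ?mulr1; last first.
    move=> k ki; rewrite -[RHS]t1; apply: eq_bigr => r _.
    by rewrite /g (negbTE ki) !mulr1.
  under eq_bigr do rewrite /g eqxx -expr2.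
  over.
by rewrite sumr_const card_ord mulr_natl.
Qed.

(** Each frequency averages N independent indicators of mean [t 0 r], so has variance
    at most [1 / N]. *)
Lemma sum_iid_weight_dist t : (0 < N)%N -> simplex R q t ->
  \sum_X iid_weight t X * (\sum_(r < q) (magnetization R X 0 r - t 0 r) ^+ 2)
  <= q%:R / N%:R.
Proof.
move=> N0 [t0 t1].
have Nn0 : N%:R != 0 :> R by rewrite pnatr_eq0 -lt0n.
pose f (r s : 'I_q) : R := (s == r)%:R - t 0 r.
have fE X r : magnetization R X 0 r - t 0 r = N%:R^-1 * \sum_(i < N) f r (X i).
  rewrite sumrB sumr_const card_ord -[t 0 r *+ N]mulr_natl mulrBr mulKf//.
  congr (_ - _).
  rewrite mxE mulrC; congr (_ * _).
  rewrite cardsE -sum1_card natr_sum big_mkcond; apply: eq_bigr => i _.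
  by rewrite (_ : (i \in _) = (X i == r))//; case: (X i == r).
under eq_bigr do rewrite mulr_sumr.
rewrite exchange_big/= [leRHS](_ : _ = \sum_(r < q) N%:R^-1); last first.
  by rewrite sumr_const card_ord mulr_natl.
apply: ler_sum => r _.
under eq_bigr do rewrite fE exprMn mulrCA.
rewrite -mulr_sumr sum_iid_weight_sqr//; last first.
  under eq_bigr do rewrite mulrBr.
  rewrite sumrB -mulr_suml t1 mul1r (bigD1 r)//= eqxx mulr1 big1 ?addr0 ?subrr//.
  by move=> s /negbTE ->; rewrite mulr0.
rewrite expr2 -!mulrA mulKf// ler_piMr ?invr_ge0//.
rewrite -[leRHS]t1; apply: ler_sum => s _; rewrite ler_piMr//.
have tr1 : t 0 r <= 1 by rewrite -t1 (bigD1 r)//= lerDl sumr_ge0.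
have := t0 r; rewrite /f; case: (_ == _) => /= ?; nra.
Qed.

(** Chebyshev's inequality: the indicator of [A] is at least 1 minus the squared
    distance to [t] divided by [d]. *)
Lemma iid_weight_near t (A : pred (config r1 N)) (d : R) :
  (0 < N)%N -> simplex R q t -> 0 < d ->
  (forall X, \sum_(r < q) (magnetization R X 0 r - t 0 r) ^+ 2 < d -> A X) ->
  1 - q%:R / N%:R / d <= \sum_(X | A X) iid_weight t X.
Proof.
move=> N0 st d0 dA; have [t0 t1] := st.
apply: (@le_trans _ _ (\sum_X iid_weight t X *
    (1 - (\sum_(r < q) (magnetization R X 0 r - t 0 r) ^+ 2) / d))).
  under eq_bigr do rewrite mulrBr mulr1 mulrA.
  rewrite sumrB sum_iid_weight// -mulr_suml lerB// ler_pM2r ?invr_gt0//.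
  exact: sum_iid_weight_dist.
rewrite [leRHS]big_mkcond/=; apply: ler_sum => X _.
have w0 := iid_weight_ge0 X t0.
case: ifPn => [_|].
  rewrite ler_piMr// lerBlDr lerDl divr_ge0 ?(ltW d0)//.
  by apply: sumr_ge0 => r _; exact: sqr_ge0.
move=> /negP nA; rewrite mulr_ge0_le0// subr_le0 ler_pdivlMr// mul1r leNgt.
by apply/negP => /dA.
Qed.

(** Equality fails only when some [t_(X_i)] is 0, and then the left side is 0;
    the junk value [ln 0 = 0] is therefore harmless. *)
Lemma iid_weight_le_expR t X : (forall r, 0 <= t 0 r) ->
  iid_weight t X <=
    expR (N%:R * \sum_(r < q) magnetization R X 0 r * ln (t 0 r)).
Proof.
move=> t0; rewrite -(sum_sites (fun r => ln (t 0 r))) expR_sum.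
apply: ler_prod => i _; rewrite t0/=.
have [->|tn0] := eqVneq (t 0 (X i)) 0; first by rewrite expR_ge0.
by rewrite lnK// posrE lt_neqAle eq_sym tn0 t0.
Qed.

(** No factor vanishes here, since every colour occurring in [X] has positive
    frequency. *)
Lemma iid_weight_magnetization X :
  iid_weight (magnetization R X) X = expR (N%:R *
    \sum_(r < q) magnetization R X 0 r * ln (magnetization R X 0 r)).
Proof.
rewrite -(sum_sites (fun r => ln (magnetization R X 0 r))) expR_sum.
apply: eq_bigr => i _; rewrite lnK// posrE mxE divr_gt0//.
  by rewrite ltr0n card_gt0; apply/set0Pn; exists i; rewrite inE.
by rewrite ltr0n (leq_ltn_trans _ (ltn_ord i)).
Qed.

(** Method of types: the parameter depends on the configuration, so bound each
    weight by the sum of the weights over all possible frequency vectors; for a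
    fixed vector they sum to 1. *)
Lemma sum_iid_weight_magnetization : (0 < N)%N ->
  \sum_X iid_weight (magnetization R X) X <= (N.+1 ^ q)%:R.
Proof.
move=> N0.
pose freq (k : {ffun 'I_q -> 'I_N.+1}) : 'rV[R]_q := \row_r ((k r)%:R / N%:R).
pose is_type (k : {ffun 'I_q -> 'I_N.+1}) := \sum_(r < q) freq k 0 r == 1.
apply: (@le_trans _ _ (\sum_X \sum_(k | is_type k) iid_weight (freq k) X)).
  apply: ler_sum => X _.
  pose k : {ffun 'I_q -> 'I_N.+1} := [ffun r => inord #|[set i | X i == r]%SET|].
  have kE : freq k = magnetization R X.
    apply/rowP => r; rewrite !mxE ffunE inordK//.
    by rewrite ltnS (leq_trans (max_card _))// card_ord.
  have kt : is_type k.
    by apply/eqP; rewrite kE; have [] := magnetization_simplex R X N0.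
  rewrite (bigD1 k)//= kE lerDl sumr_ge0// => l _.
  by apply: iid_weight_ge0 => r; rewrite mxE divr_ge0.
rewrite exchange_big/=.
under eq_bigr => k /eqP kt do rewrite sum_iid_weight//.
rewrite sumr_const ler_nat (leq_trans (max_card _))//.
by rewrite card_ffun !card_ord.
Qed.

End iid.

(** * Bounds on restricted partition functions *)

Definition interaction (R : realType) (p q : nat) (r1 : 'I_q) (beta h : R)
    (t : 'rV[R]_q) : R :=
  beta * \sum_(r < q) t 0 r ^+ p + h * t 0 r1.

Section partition_bounds.
Context (R : realType) (p q N : nat) (r1 : 'I_q) (beta h : R).
Implicit Types (t : 'rV[R]_q) (X : config r1 N) (A : set (config r1 N)).

Local Notation H := (neg_free_energy p r1 beta h).

Definition restricted_partition A : R := \sum_(X | X \in A) boltzmann p beta h X.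

Lemma pottsE A : potts p N r1 beta h A =
  (restricted_partition A / restricted_partition [set: config r1 N])%:E.
Proof.
have -> : restricted_partition [set: config r1 N] = partition_function p N r1 beta h.
  by apply: eq_bigl => X; rewrite in_setT.
rewrite /potts /restricted_partition mulr_suml -sumEFin [RHS]big_mkcond/=.
apply: eq_bigr => X _; rewrite diracE.
by case: (X \in A); rewrite ?mule1 ?mule0.
Qed.

Lemma boltzmannE X :
  boltzmann p beta h X = expR (N%:R * interaction p r1 beta h (magnetization R X)).
Proof. by rewrite /boltzmann /interaction; congr expR; ring. Qed.

(** The Boltzmann weight is [exp (N * H)] at the magnetization times the product
    weight whose parameter is that magnetization, and the latter weights sum to at
    most [(N+1)^q]. *)
Lemma restricted_partition_le A m : (0 < N)%N ->
  (forall X, A X -> H (magnetization R X) <= m) ->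
  restricted_partition A <= expR (N%:R * m) * (N.+1 ^ q)%:R.
Proof.
move=> N0 Am.
apply: (@le_trans _ _ (\sum_(X : config r1 N)
    expR (N%:R * m) * iid_weight (magnetization R X) X)); last first.
  by rewrite -mulr_sumr ler_wpM2l ?expR_ge0// sum_iid_weight_magnetization.
rewrite /restricted_partition big_mkcond/=; apply: ler_sum => X _.
rewrite iid_weight_magnetization -expRD.
case: ifPn => [/set_mem AX|_]; last exact: expR_ge0.
rewrite boltzmannE ler_expR -mulrDr ler_wpM2l// -lerBlDr.
exact: Am.
Qed.

(** Change of measure: multiplying the product weight of parameter [t] by
    [exp (- N sum_r x_r ln t_r)], for x the magnetization, yields at most 1, so a
    Boltzmann weight is at least [exp (N m)] times that product weight, to which
    Chebyshev's inequality applies. *)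
Lemma restricted_partition_ge A t (m d : R) : (0 < N)%N -> simplex R q t -> 0 < d ->
  (forall X, \sum_(r < q) (magnetization R X 0 r - t 0 r) ^+ 2 < d ->
     A X /\ m <= interaction p r1 beta h (magnetization R X) -
                 \sum_(r < q) magnetization R X 0 r * ln (t 0 r)) ->
  expR (N%:R * m) * (1 - q%:R / N%:R / d) <= restricted_partition A.
Proof.
move=> N0 st d0 dA.
pose B X := \sum_(r < q) (magnetization R X 0 r - t 0 r) ^+ 2 < d.
apply: (@le_trans _ _ (expR (N%:R * m) * \sum_(X | B X) iid_weight t X)).
  rewrite ler_wpM2l ?expR_ge0//; exact: iid_weight_near.
rewrite mulr_sumr big_mkcond [leRHS]big_mkcond/=; apply: ler_sum => X _.
case: ifPn => [/dA[AX mX]|_]; last by case: ifP => // _; exact: expR_ge0.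
rewrite (mem_set AX) boltzmannE.
apply: (le_trans (ler_wpM2l (expR_ge0 _) (iid_weight_le_expR X st.1))).
by rewrite -expRD ler_expR -mulrDr ler_wpM2l// -lerBrDr.
Qed.

End partition_bounds.

Section perturbation.
Context (R : realType) (p q : nat) (r1 : 'I_q).

Lemma interaction_dist (beta h beta' h' : R) (t : 'rV[R]_q) :
  simplex R q t ->
  `|interaction p r1 beta' h' t - interaction p r1 beta h t| <=
    `|beta' - beta| * q%:R + `|h' - h|.
Proof.
move=> [t0 t1].
have tle1 r : t 0 r <= 1 by rewrite -t1 (bigD1 r)//= lerDl sumr_ge0.
have -> : interaction p r1 beta' h' t - interaction p r1 beta h t =
  (beta' - beta) * \sum_(r < q) t 0 r ^+ p + (h' - h) * t 0 r1.
  by rewrite /interaction; ring.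
rewrite (le_trans (ler_normD _ _))// !normrM lerD//; last first.
  by rewrite ler_piMr// ger0_norm.
rewrite ler_wpM2l// ger0_norm; last by rewrite sumr_ge0// => r _; rewrite exprn_ge0.
rewrite -[q in q%:R]card_ord -sum1_card natr_sum ler_sum// => r _.
exact: exprn_ile1.
Qed.

Lemma interaction_cvg (betaN hN : nat -> R) (beta h eps : R) :
  betaN @ \oo --> beta -> hN @ \oo --> h -> 0 < eps ->
  \forall N \near \oo, forall t : 'rV[R]_q, simplex R q t ->
    `|interaction p r1 (betaN N) (hN N) t - interaction p r1 beta h t| <= eps.
Proof.
move=> betaNb hNh e0.
have q0 : 0 < q%:R :> R by rewrite ltr0n (leq_ltn_trans _ (ltn_ord r1)).
near=> N => t st; apply: (le_trans (interaction_dist _ _ _ _ st)).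
rewrite [leRHS]splitr lerD// -?ler_pdivlMr//; near: N.
  by apply: cvgr_distC_le => //; rewrite !divr_gt0.
by apply: cvgr_distC_le => //; rewrite divr_gt0.
Unshelve. all: by end_near. Qed.

End perturbation.

(** * Elementary asymptotics and continuity *)

Section asymptotics.
Context (R : realType).

(** The number of types is subexponential. The tangent inequality
    [ln y < y] at [y = c (N+1)] gives [ln (N+1) <= c (N+1) - ln c] with a slope
    [c] that can be taken small. *)
Lemma natr_exp_le_expR (q : nat) (eps : R) : 0 < eps ->
  \forall N \near \oo, (N.+1 ^ q)%:R <= expR (N%:R * eps) :> R.
Proof.
move=> e0; pose c : R := eps / 2 / q.+1%:R.
have c0 : 0 < c by rewrite !divr_gt0.
near=> N.
have x0 : 0 < c * N.+1%:R by rewrite mulr_gt0.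
have -> : (N.+1 ^ q)%:R = expR (q%:R * ln N.+1%:R) :> R.
  by rewrite expRM_natl lnK ?posrE// natrX.
rewrite ler_expR.
have : ln N.+1%:R <= c * N.+1%:R - ln c :> R.
  by rewrite lerBrDr addrC -lnM ?posrE// ltW// ln_sublinear.
move=> /(ler_wpM2l (ler0n R q)) /le_trans; apply.
rewrite mulrBr.
have : q%:R * (c * N.+1%:R) <= eps / 2 * N.+1%:R.
  rewrite mulrA ler_wpM2r// /c mulrCA ler_piMr ?divr_ge0 ?ltW//.
  by rewrite ltr_pdivrMr// mul1r ltr_nat.
have : eps / 2 - q%:R * ln c <= eps / 2 * N%:R.
  rewrite -ler_pdivrMl ?divr_gt0//.
  near: N; exact: nbhs_infty_ger.
have -> : N.+1%:R = N%:R + 1 :> R by rewrite natr1.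
move: (q%:R * (c * (N%:R + 1))) (q%:R * ln c) => a b; nra.
Unshelve. all: by end_near. Qed.

(** The Chebyshev factor tends to 1 and the exponential to 0; both eventually
    pass [1 / 2]. *)
Lemma expR_le_chebyshev (q : nat) (d eps : R) : 0 < d -> 0 < eps ->
  \forall N \near \oo, expR (- (N%:R * eps)) <= 1 - q%:R / N%:R / d.
Proof.
move=> d0 e0; near=> N.
have N0 : 0 < N%:R :> R by rewrite ltr0n; near: N; exact: nbhs_infty_gt.
apply: (@le_trans _ _ (1 / 2)).
  rewrite expRN -[leRHS]invrK lef_pV2 ?posrE ?expR_gt0 ?invr_gt0//.
  rewrite (le_trans _ (expR_ge1Dx _))//.
  rewrite div1r invrK.
  have : 1 / eps <= N%:R by near: N; exact: nbhs_infty_ger.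
  rewrite ler_pdivrMr//; lra.
rewrite lerBrDr -lerBrDl ler_pdivrMr// ler_pdivrMr//.
have : q%:R / d * 2 <= N%:R by near: N; exact: nbhs_infty_ger.
rewrite -ler_pdivlMr// ler_pdivrMr//; nra.
Unshelve. all: by end_near. Qed.

Lemma nbhs_rV_sqrdist (q : nat) (t : 'rV[R]_q) (U : set 'rV[R]_q) : nbhs t U ->
  exists2 d : R, 0 < d &
    forall s : 'rV[R]_q, \sum_(r < q) (s 0 r - t 0 r) ^+ 2 < d -> U s.
Proof.
move=> /nbhs_ballP[e /= e0 eU]; exists (e ^+ 2); first exact: exprn_gt0.
move=> s st; apply: eU; split => // i r; rewrite ord1 /ball/= distrC.
rewrite -(@ltr_pXn2r _ 2)// ?nnegrE ?(ltW e0)// real_normK ?num_real//.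
apply: le_lt_trans st; rewrite (bigD1 r)//= lerDl sumr_ge0// => k _.
exact: sqr_ge0.
Qed.

Lemma sum_continuous (T : topologicalType) (I : Type) (r : seq I)
    (F : I -> T -> R) :
  (forall i, continuous (F i)) -> continuous (fun x => \sum_(i <- r) F i x).
Proof. by move=> Fc; apply: continuous_big => //; exact: add_continuous. Qed.

Lemma interaction_continuous p q (r1 : 'I_q) (beta h : R) :
  continuous (interaction p r1 beta h).
Proof.
have pc : continuous (fun t : 'rV[R]_q => \sum_(r < q) t 0 r ^+ p).
  apply: sum_continuous => r s.
  apply: (@continuous_comp _ _ _ (fun u : 'rV[R]_q => u 0 r) (fun x => x ^+ p)).
    exact: coord_continuous.
  exact: exprn_continuous.
move=> t; exact: cvgD (cvgMl_tmp (pc t)) (cvgMl_tmp (@coord_continuous _ _ _ _ _ t)).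
Qed.

End asymptotics.

(** * Continuity of the free energy *)

Section free_energy.
Context (R : realType).

(** As [ln] vanishes on the nonpositive reals, this function is continuous on the
    whole line, and H on the whole space; at 0, [x = z ^ 2] and [ln z^-1 < z^-1]
    give [|x ln x| < 2 z]. *)
Lemma xlnx_continuous : continuous (fun x : R => x * ln x).
Proof.
move=> x; have [x0|x0|->] := ltgtP x 0.
- rewrite /continuous_at [X in _ --> X](_ : _ = 0); last by rewrite ln0 ?mulr0// ltW.
  apply: cvg_near_cst; near=> y.
  rewrite ln0 ?mulr0//; near: y; apply: filterS (lt_nbhsl x0) => y; exact: ltW.
- by apply: cvgM; [exact: cvg_id|exact: continuous_ln].
suff x0 : (y * ln y) @[y --> (0 : R)] --> (0 : R) by rewrite /continuous_at mul0r.
apply/cvgr0Pnorm_lt => e e0.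
near=> y.
have [y0|y0] := leP y 0; first by rewrite ln0// mulr0 normr0.
have ye : `|y| < (e / 2) ^+ 2.
  by near: y; apply: (@nbhs0_lt R R); rewrite exprn_gt0// divr_gt0.
have y1 : `|y| < 1 by near: y; exact: (@nbhs0_lt R R).
rewrite gtr0_norm// in ye y1.
pose z := Num.sqrt y; have z0 : 0 < z by rewrite sqrtr_gt0.
have yz : y = z ^+ 2 by rewrite sqr_sqrtr// ltW.
have ze : z < e / 2.
  by rewrite -(@ltr_pXn2r _ 2)// ?nnegrE -?yz// ltW// divr_gt0.
rewrite ler0_norm; last by rewrite mulr_ge0_le0 ?(ltW y0)// ln_le0// ltW.
rewrite yz lnXn//.
have := @ln_sublinear _ z^-1; rewrite invr_gt0 => /(_ z0).
rewrite lnV ?posrE// => lz.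
have : z * - ln z < 1 by rewrite -(@divff _ z) ?gt_eqF// ltr_pM2l.
rewrite mulr2n; nra.
Unshelve. all: by end_near. Qed.

Lemma neg_free_energyE p q (r1 : 'I_q) (beta h : R) t :
  neg_free_energy p r1 beta h t =
  interaction p r1 beta h t - \sum_(r < q) t 0 r * ln (t 0 r).
Proof. by []. Qed.

Lemma neg_free_energy_continuous p q (r1 : 'I_q) (beta h : R) :
  continuous (neg_free_energy p r1 beta h).
Proof.
have sc : continuous (fun t : 'rV[R]_q => \sum_(r < q) t 0 r * ln (t 0 r)).
  apply: sum_continuous => r s.
  apply: (@continuous_comp _ _ _ (fun u : 'rV[R]_q => u 0 r) (fun x => x * ln x)).
    exact: coord_continuous.
  exact: xlnx_continuous.
move=> t; exact: cvgB (@interaction_continuous R p q r1 beta h t) (sc t).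
Qed.

End free_energy.

(** * Exponential rates of the Gibbs measure *)

Section exponential_rates.
Context (R : realType) (p q : nat) (r1 : 'I_q) (beta h : R).
Context (betaN hN : nat -> R).
Context (betaNE : betaN @ \oo --> beta) (hNE : hN @ \oo --> h).

Local Notation H := (neg_free_energy p r1 beta h).
Local Notation Z N A :=
  (restricted_partition p (betaN N) (hN N) (A : set (config r1 N))).

Lemma near_restricted_partition_le (A : forall N, set (config r1 N)) (m eps : R) :
  0 < eps ->
  (forall N X, (0 < N)%N -> A N X -> H (magnetization R X) <= m) ->
  \forall N \near \oo, Z N (A N) <= expR (N%:R * (m + eps)).
Proof.
move=> e0 Am; have e20 : 0 < eps / 2 by rewrite divr_gt0.
near=> N.
have N0 : (0 < N)%N by near: N; exact: nbhs_infty_gt.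
apply: (@le_trans _ _ (expR (N%:R * (m + eps / 2)) * (N.+1 ^ q)%:R)).
  apply: restricted_partition_le => // X AX.
  have NE : `|interaction p r1 (betaN N) (hN N) (magnetization R X) -
              interaction p r1 beta h (magnetization R X)| <= eps / 2.
    move: (magnetization R X) (magnetization_simplex R X N0).
    by near: N; exact: interaction_cvg.
  move: NE (Am _ _ N0 AX); rewrite !neg_free_energyE ler_distl => /andP[_]; lra.
have -> : N%:R * (m + eps) = N%:R * (m + eps / 2) + N%:R * (eps / 2) by field.
rewrite [leRHS]expRD ler_wpM2l ?expR_ge0//.
by near: N; exact: natr_exp_le_expR.
Unshelve. all: by end_near. Qed.

Lemma near_restricted_partition_ge (A : forall N, set (config r1 N))
    (t : 'rV[R]_q) (U : set 'rV[R]_q) (eps : R) :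
  0 < eps -> simplex R q t -> nbhs t U ->
  (forall N X, (0 < N)%N -> U (magnetization R X) -> A N X) ->
  \forall N \near \oo, expR (N%:R * (H t - eps)) <= Z N (A N).
Proof.
move=> e0 st tU UA; have e30 : 0 < eps / 3 by rewrite divr_gt0.
(* The exponent left by the change of measure to the product measure of
   parameter [t]; it is continuous in [s] because [t] is fixed, and [G t = H t]. *)
pose G (s : 'rV[R]_q) :=
  interaction p r1 beta h s - \sum_(r < q) s 0 r * ln (t 0 r).
have Gc : continuous G.
  have sc : continuous (fun s : 'rV[R]_q => \sum_(r < q) s 0 r * ln (t 0 r)).
    apply: sum_continuous => r s.
    exact: cvgMr_tmp (@coord_continuous _ _ _ _ _ s).
  move=> s; exact: cvgB (@interaction_continuous R p q r1 beta h s) (sc s).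
have tUG : nbhs t (U `&` [set s | H t - eps / 3 <= G s]).
  apply: (filterI tU); apply: (cvgr_ge (G t) (Gc t)).
  by rewrite ltrBlDr ltrDl.
have [d d0 dU] := nbhs_rV_sqrdist tUG.
near=> N.
have N0 : (0 < N)%N by near: N; exact: nbhs_infty_gt.
(* One third of [eps] each for the oscillation of [G], the change of the
   parameters and the Chebyshev factor. *)
apply: (@le_trans _ _ (expR (N%:R * (H t - eps / 3 - eps / 3)) *
    (1 - q%:R / N%:R / d))).
  apply: (@le_trans _ _ (expR (N%:R * (H t - eps / 3 - eps / 3)) *
      expR (- (N%:R * (eps / 3))))).
    by rewrite -expRD ler_expR; lra.
  by rewrite ler_wpM2l ?expR_ge0//; near: N; exact: expR_le_chebyshev.
apply: (restricted_partition_ge N0 st d0) => X /dU[/= UX GX].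
split; first exact: UA N0 UX.
have : `|interaction p r1 (betaN N) (hN N) (magnetization R X) -
            interaction p r1 beta h (magnetization R X)| <= eps / 3.
  move: (magnetization R X) (magnetization_simplex R X N0).
  by near: N; exact: interaction_cvg.
rewrite ler_distl => /andP[+ _]; move: GX; rewrite /G; lra.
Unshelve. all: by end_near. Qed.

Context (s0 : 'rV[R]_q) (s0max : maximizers p r1 beta h s0).

(** The normalizing sum is at least [exp (N (H s0 - eps / 2))], by the lower bound
    at [t = s0]. *)
Lemma near_potts_le (A : forall N, set (config r1 N)) (m eps : R) :
  0 < eps ->
  (forall N X, (0 < N)%N -> A N X -> H (magnetization R X) <= m) ->
  \forall N \near \oo, (potts p N r1 (betaN N) (hN N) (A N) <=
    (expR (N%:R * (m - H s0 + eps)))%:E)%E.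
Proof.
move=> e0 Am; have e20 : 0 < eps / 2 by rewrite divr_gt0.
near=> N; rewrite pottsE lee_fin.
have Zge : expR (N%:R * (H s0 - eps / 2)) <= Z N setT.
  near: N; apply: (near_restricted_partition_ge (A := fun=> setT) (U := setT)) => //.
    by case: s0max.
  exact: filterT.
rewrite ler_pdivrMr; last exact: lt_le_trans (expR_gt0 _) Zge.
apply: (le_trans _ (ler_wpM2l (expR_ge0 _) Zge)).
have E : m - H s0 + eps + (H s0 - eps / 2) = m + eps / 2 by field.
rewrite -expRD -mulrDr E.
by near: N; exact: near_restricted_partition_le.
Unshelve. all: by end_near. Qed.

(** The normalizing sum is at most [exp (N (H s0 + eps / 2))], as [H s0] bounds H. *)
Lemma near_potts_ge (A : forall N, set (config r1 N))
    (t : 'rV[R]_q) (U : set 'rV[R]_q) (eps : R) :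
  0 < eps -> simplex R q t -> nbhs t U ->
  (forall N X, (0 < N)%N -> U (magnetization R X) -> A N X) ->
  \forall N \near \oo, ((expR (N%:R * (H t - H s0 - eps)))%:E <=
    potts p N r1 (betaN N) (hN N) (A N))%E.
Proof.
move=> e0 st tU UA; have e20 : 0 < eps / 2 by rewrite divr_gt0.
near=> N; rewrite pottsE lee_fin.
have Zge : expR (N%:R * (H s0 - eps / 2)) <= Z N setT.
  near: N; apply: (near_restricted_partition_ge (A := fun=> setT) (U := setT)) => //.
    by case: s0max.
  exact: filterT.
rewrite ler_pdivlMr; last exact: lt_le_trans (expR_gt0 _) Zge.
have Zle : Z N setT <= expR (N%:R * (H s0 + eps / 2)).
  near: N; apply: (near_restricted_partition_le (A := fun=> setT)) => // N X N0 _.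
  by apply: s0max.2; exact: magnetization_simplex.
apply: (le_trans (ler_wpM2l (expR_ge0 _) Zle)).
have E : H t - H s0 - eps + (H s0 + eps / 2) = H t - eps / 2 by field.
rewrite -expRD -mulrDr E.
by near: N; exact: near_restricted_partition_ge tU _.
Unshelve. all: by end_near. Qed.

End exponential_rates.

(** * Compactness and the gap below the maximum *)

Section simplex_topology.
Context (R : realType) (q : nat).

Lemma simplex_compact : compact (simplex R q).
Proof.
have cube := @rV_compact R q (fun=> `[0, 1]%classic)
  (fun=> @segment_compact R 0 1).
apply: (subclosed_compact _ cube); last first.
  move=> t [t0 t1] r /=; rewrite in_itv/= t0/=.
  by rewrite -t1 (bigD1 r)//= lerDl sumr_ge0.
have -> : simplex R q = \bigcap_r [set t : 'rV[R]_q | 0 <= t 0 r] `&`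
    [set t | \sum_(r < q) t 0 r = 1].
  by apply/seteqP; split=> t [t0 t1]; split => // r; [move=> _|]; exact: t0.
apply: closedI.
  apply: closed_bigI => r _.
  apply: (@preimage_closed _ _ (fun t : 'rV[R]_q => t 0 r) [set x | 0 <= x]).
    by move=> t _; exact: coord_continuous.
  exact: closed_ge.
apply: (@preimage_closed _ _ (fun t : 'rV[R]_q => \sum_(r < q) t 0 r)
  [set x | x = 1]).
  by move=> t _; apply: sum_continuous => r s; exact: coord_continuous.
exact: closed_eq.
Qed.

Lemma l2norm_continuous : continuous (@l2norm R q).
Proof.
move=> u.
apply: (@continuous_comp _ _ _ (fun t : 'rV[R]_q => \sum_(r < q) t 0 r ^+ 2)
  Num.sqrt).
  apply: sum_continuous => r s.
  apply: (@continuous_comp _ _ _ (fun u : 'rV[R]_q => u 0 r) (fun x => x ^+ 2)).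
    exact: coord_continuous.
  exact: exprn_continuous.
exact: sqrt_continuous.
Qed.

Lemma l2norm0 : l2norm (0 : 'rV[R]_q) = 0.
Proof. by rewrite /l2norm big1 ?sqrtr0// => r _; rewrite mxE expr0n. Qed.

(** An intersection of closed conditions, one for each point of [A]; this covers
    the empty [A], at distance [+oo] from every point. *)
Lemma closed_l2dist_ge (A : set 'rV[R]_q) (eps : R) :
  closed [set t | (eps%:E <= l2dist t A)%E].
Proof.
have -> : [set t | (eps%:E <= l2dist t A)%E] =
    \bigcap_(a in A) [set t | eps <= l2norm (t - a)].
  apply/seteqP; split=> t /=.
    move=> et a Aa /=; rewrite -lee_fin; apply: le_trans et _.
    by apply: ereal_inf_lbound; exists a.
  by move=> et; apply: le_ereal_inf_tmp => _ [a Aa <-]; rewrite lee_fin; exact: et.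
apply: closed_bigI => a _.
apply: (@preimage_closed _ _ (fun t : 'rV[R]_q => l2norm (t - a))
  [set x | eps <= x]).
  move=> t _.
  apply: (@continuous_comp _ _ _ (fun t : 'rV[R]_q => t - a) (@l2norm R q)).
    exact: cvgB cvg_id (cvg_cst a).
  exact: l2norm_continuous.
exact: closed_ge.
Qed.

End simplex_topology.

Section free_energy_maximum.
Context (R : realType) (p q : nat) (r1 : 'I_q) (beta h : R).

Local Notation H := (neg_free_energy p r1 beta h).

Lemma maximizers_nonempty : exists t, maximizers p r1 beta h t.
Proof.
have simplex0 : simplex R q !=set0.
  exists (\row_r (r == r1)%:R); split=> [r|]; first by rewrite mxE.
  by rewrite (bigD1 r1)//= mxE eqxx big1 ?addr0// => r /negbTE; rewrite mxE => ->.
have [t /set_mem st tmax] := EVT_max_rV simplex0 (@simplex_compact R q)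
  (continuous_subspaceT (@neg_free_energy_continuous R p q r1 beta h)).
by exists t; split => // s ss; apply: tmax; exact: mem_set.
Qed.

Lemma sup_neg_free_energy t : maximizers p r1 beta h t ->
  sup (H @` simplex R q) = H t.
Proof.
move=> [st tmax]; apply/le_anti/andP; split.
  by apply: ge_sup; [exists (H t), t|move=> _ [s ss <-]; exact: tmax].
apply: ub_le_sup; last by exists t.
by exists (H t) => _ [s ss <-]; exact: tmax.
Qed.

(** On the compact set of points far from the maximizers H attains its supremum;
    if it were the global one, the point attaining it would be a maximizer, at
    distance 0 from the set of maximizers. *)
Lemma neg_free_energy_gap t (eps : R) : 0 < eps -> maximizers p r1 beta h t ->
  exists2 m, m < H t & forall s, simplex R q s ->
    (eps%:E <= l2dist s (maximizers p r1 beta h))%E -> H s <= m.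
Proof.
move=> e0 [st tmax].
pose F := simplex R q `&` [set s | (eps%:E <= l2dist s (maximizers p r1 beta h))%E].
have [F0|/set0P F0] := eqVneq F set0.
  exists (H t - 1); first by rewrite ltrBlDr ltrDl.
  by move=> s ss es; have : F s by []; rewrite F0.
have Fc : compact F.
  apply: (subclosed_compact _ (@simplex_compact R q)) => [|s []//].
  apply: closedI; last exact: closed_l2dist_ge.
  by apply: compact_closed; [exact: norm_hausdorff|exact: simplex_compact].
have [s /set_mem [ss es] smax] := EVT_max_rV F0 Fc
  (continuous_subspaceT (@neg_free_energy_continuous R p q r1 beta h)).
exists (H s); last by move=> u su eu; apply: smax; exact: mem_set.
rewrite ltNge; apply/negP => ts.
have Ms : maximizers p r1 beta h s.
  by split => // u su; exact: le_trans (tmax _ su) ts.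
have : (eps%:E <= 0)%E.
  apply: le_trans es _; apply: ereal_inf_lbound; exists s => //.
  by rewrite subrr l2norm0.
by rewrite lee_fin leNgt e0.
Qed.

End free_energy_maximum.

(** * The large deviation principle *)

Section rates.
Context (R : realType).
Implicit Types (u : nat -> \bar R) (x : \bar R).

Lemma limn_esup_le_near u x : (\forall n \near \oo, (u n <= x)%E) ->
  (limn_esup u <= x)%E.
Proof.
move=> ux; apply: (@le_trans _ _ (ereal_sup (u @` [set n | (u n <= x)%E]))).
  by apply: ereal_inf_lbound; exists [set n | (u n <= x)%E].
by apply: ge_ereal_sup => _ [n nx <-].
Qed.

Lemma limn_einf_ge_near u x : (\forall n \near \oo, (x <= u n)%E) ->
  (x <= limn_einf u)%E.
Proof.
move=> ux; rewrite -[limn_einf u]oppeK -limn_esupN leeNr; apply: limn_esup_le_near.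
by apply: filterS ux => n; rewrite /= leeN2.
Qed.

Lemma lne_rate_le (N : nat) x (a : R) : (0 < N)%N -> (0 <= x)%E ->
  (x <= (expR (N%:R * a))%:E)%E -> ((N%:R)^-1%:E * lne x <= a%:E)%E.
Proof.
move=> N0 x0 xa.
have -> : a%:E = ((N%:R)^-1%:E * (N%:R * a)%:E)%E.
  by rewrite -EFinM mulKf// pnatr_eq0 -lt0n.
rewrite lee_wpmul2l ?lee_fin// -[leRHS]expeRK lee_lne//.
  by rewrite in_itv/= x0 leey.
by rewrite in_itv/= leey lee_fin expR_ge0.
Qed.

Lemma lne_rate_ge (N : nat) x (a : R) : (0 < N)%N ->
  ((expR (N%:R * a))%:E <= x)%E -> (a%:E <= (N%:R)^-1%:E * lne x)%E.
Proof.
move=> N0 xa.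
have -> : a%:E = ((N%:R)^-1%:E * (N%:R * a)%:E)%E.
  by rewrite -EFinM mulKf// pnatr_eq0 -lt0n.
rewrite lee_wpmul2l ?lee_fin// -[leLHS]expeRK lee_lne//.
  by rewrite in_itv/= leey lee_fin expR_ge0.
by rewrite in_itv/= leey (le_trans _ xa)// lee_fin expR_ge0.
Qed.

End rates.

Section ldp.
Context (R : realType) (p q : nat) (r1 : 'I_q) (beta h : R).
Context (betaN hN : nat -> R).
Context (betaNE : betaN @ \oo --> beta) (hNE : hN @ \oo --> h).

Local Notation H := (neg_free_energy p r1 beta h).
Local Notation I := (rate_function p r1 beta h).
Local Notation mu N := (magnetization_law p N r1 (betaN N) (hN N)).

Lemma rate_functionE s0 (t : simplex R q) : maximizers p r1 beta h s0 ->
  I t = (H s0 - H (set_val t))%:E.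
Proof. by move=> /sup_neg_free_energy E; rewrite /rate_function E addrC. Qed.

Lemma rate_function_ge0 t : (0 <= I t)%E.
Proof.
have [s0 s0max] := maximizers_nonempty p r1 beta h.
rewrite (rate_functionE _ s0max) lee_fin subr_ge0; apply: s0max.2.
exact: set_valP.
Qed.

Lemma rate_function_lsc : lower_semicontinuous I.
Proof.
move=> t a; rewrite lte_fin => at_.
pose f (s : simplex R q) := - H (set_val s) + sup (H @` simplex R q).
have fc : f @ t --> f t.
  have Hc : (H \o set_val) @ t --> H (set_val t).
    apply: (@continuous_comp _ _ _ (set_val : simplex R q -> 'rV[R]_q) H).
      exact: initial_continuous.
    exact: neg_free_energy_continuous.
  exact: cvgD (cvgN Hc) (cvg_cst _).
exists [set s | a < f s]; first by apply: (cvgr_gt (f t) fc).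
by move=> s; rewrite /= lte_fin.
Qed.

(** An open set of the simplex is the trace of an open set [V] of the whole space,
    and [V] serves as the neighbourhood of [t] in the bound on probabilities. *)
Lemma ldp_lower_bound (A : set (simplex R q)) :
  (- ereal_inf (I @` interior A) <=
   limn_einf (fun N => (N%:R)^-1%:E * lne (mu N A)))%E.
Proof.
have [s0 s0max] := maximizers_nonempty p r1 beta h.
rewrite leeNl; apply: le_ereal_inf_tmp => _ [t At <-]; rewrite leeNl.
rewrite (rate_functionE _ s0max) -EFinN opprB.
apply/lee_subgt0Pr => e e0; rewrite -EFinB.
have [B [[V Vo VB] Bt BA]] : nbhs t A := At.
apply: limn_einf_ge_near; near=> N.
have N0 : (0 < N)%N by near: N; exact: nbhs_infty_gt.
apply: lne_rate_ge => //; near: N.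
apply: (near_potts_ge betaNE hNE s0max (U := V)
  (A := fun N => [set X | (set_val @` A) (magnetization R X)]) e0).
- exact: set_valP.
- by apply: open_nbhs_nbhs; split => //; move: Bt; rewrite -VB.
- move=> N X N0 VX.
  pose s : simplex R q := SigSub (mem_set (magnetization_simplex R X N0)).
  by exists s => //; apply: BA; rewrite -VB.
Unshelve. all: by end_near. Qed.

(** A set of configurations may have probability 0 for infinitely many N without
    [A] being empty, but the bounds on probabilities cover that case too; only
    for empty [A] is the right side not a finite number. *)
Lemma ldp_upper_bound (A : set (simplex R q)) :
  (limn_esup (fun N => (N%:R)^-1%:E * lne (mu N A)) <=
   - ereal_inf (I @` closure A))%E.
Proof.
have [s0 s0max] := maximizers_nonempty p r1 beta h.
have [->|/set0P[a0 Aa0]] := eqVneq A set0.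
  apply: limn_esup_le_near; near=> N.
  rewrite le0_lneNy; last first.
    rewrite /magnetization_law (_ : [set X | _] = set0) ?measure0//.
    by apply/seteqP; split => // X [].
  rewrite gt0_muleNy ?leNye// lte_fin invr_gt0 ltr0n.
  by near: N; exact: nbhs_infty_gt.
set x := (- _)%E.
have Ax a : A a -> ((H (set_val a) - H s0)%:E <= x)%E.
  move=> Aa; rewrite /x leeNr -EFinN opprB -(rate_functionE _ s0max).
  by apply: ereal_inf_lbound; exists a => //; exact: subset_closure.
have x0 : (x <= 0)%E.
  rewrite /x leeNl oppe0; apply: le_ereal_inf_tmp => _ [t _ <-].
  exact: rate_function_ge0.
have xfin : x \is a fin_num.
  rewrite fin_numE; apply/andP; split.
    by rewrite -ltNye (lt_le_trans _ (Ax _ Aa0))// ltNyr.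
  by rewrite -ltey (le_lt_trans x0)// ltry.
rewrite -(fineK xfin) in Ax *; move: (fine x) Ax => {x x0 xfin} x Ax.
apply/lee_addgt0Pr => e e0; rewrite -EFinD.
apply: limn_esup_le_near; near=> N.
have N0 : (0 < N)%N by near: N; exact: nbhs_infty_gt.
apply: lne_rate_le => //.
have -> : x + e = x + H s0 - H s0 + e by rewrite addrK.
near: N; apply: (near_potts_le betaNE hNE s0max
  (A := fun N => [set X | (set_val @` A) (magnetization R X)])) => //.
move=> N X N0 [a Aa <-]; rewrite -lerBlDr -lee_fin; exact: Ax.
Unshelve. all: by end_near. Qed.

End ldp.

Theorem theorem2p1 (R : realType) (p q : nat) (hp : (2 <= p)%N)
    (hq : (2 <= q)%N) (beta h : R) (hbeta : 0 < beta) (hh : 0 <= h) :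
  (forall betaN hN : nat -> R,
     betaN @ \oo --> beta -> hN @ \oo --> h ->
     large_deviation_principle
       (fun N => magnetization_law p N (color1 hq) (betaN N) (hN N))
       (fun N => N%:R)
       (rate_function p (color1 hq) beta h)) /\
  (forall eps : R, 0 < eps ->
     exists2 C : R, 0 < C &
       forall betaN hN : nat -> R,
         betaN @ \oo --> beta -> hN @ \oo --> h ->
         \forall N \near \oo,
           (potts p N (color1 hq) (betaN N) (hN N)
              [set X | (eps%:E <=
                 l2dist (magnetization R X) (maximizers p (color1 hq) beta h))%E]
            <= (expR (- C * N%:R))%:E)%E).
Proof.
split=> [betaN hN betaNE hNE|eps e0].
  split; [exact: rate_function_ge0|exact: rate_function_lsc|move=> A _ /=].
  by split; [exact: ldp_lower_bound|exact: ldp_upper_bound].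
have [s0 s0max] := maximizers_nonempty p (color1 hq) beta h.
have [m ms0 mmax] := neg_free_energy_gap e0 s0max.
set M := neg_free_energy _ _ _ _ s0 in ms0.
exists ((M - m) / 2); first by rewrite divr_gt0// subr_gt0.
move=> betaN hN betaNE hNE; near=> N.
have -> : - ((M - m) / 2) * N%:R = N%:R * (m - M + (M - m) / 2) by field.
near: N; apply: (near_potts_le betaNE hNE s0max (A := fun N =>
  [set X | (eps%:E <=
    l2dist (magnetization R X) (maximizers p (color1 hq) beta h))%E])).
  by rewrite divr_gt0// subr_gt0.
by move=> N X N0 eX; apply: mmax => //; exact: magnetization_simplex.
Unshelve. all: by end_near. Qed.
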